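(* Let $H:=(\mathbb{Z}/2^{\eta}\mathbb{Z},+)$ be endowed with the trivial linear cycle set structure and let $I:=\mathbb{Z}/2^{r}\mathbb{Z}$, where $3\le r\le\eta+1$. Let $\diamond$ be an action of $H$ on $I$. There exists $a=\pm(1+4k)$ with $0\le k<2^{r-2}$ such that $h\diamond y=a^{h}y$. When $k\ne0$, write $k=2^{u}s$ with $0\le u<r-2$ and $2\nmid s$. In each of the following four cases, the indicated set of pairs $(f_0,\gamma)$ parametrizes a complete family $(\alpha_1(\gamma),f_{f_0})$ of representatives of 2-cocycles modulo coboundaries. ($k=0$ and $a=1$) If $r\le\eta$, the set is $\{(z_1,z_2):0\le z_1,z_2<2^{r}\}$. If $r=\eta+1$, the set is $\{(2z_1,z_2):0\le z_1,z_2<2^{r-1}\}$. Moreover, in both situations, $h\diamond y=y$ and $f_{f_0}(h,h')=f_0hh'$. ($k=0$ and $a=-1$) The set is $\{(z_1,2^{r-1}z_2+2^{\eta-1}z_1):0\le z_1,z_2<2\}$. Moreover, $h\diamond y=(-1)^{h}y$, and $f_{f_0}(h,h')=f_0h'$ if $h$ is odd, $f_{f_0}(h,h')=0$ if $h$ is even. ($k\ne0$ and $a=1+4k$) If $r\le\eta$, the set is $\{(z_1,2^{r-u-2}z_2):0\le z_1,z_2<2^{u+2}\}$. If $r=\eta+1$, the set is $\{(2z_1,2^{r-u-2}z_2-2^{\eta-u-1}z_1):0\le z_1<2^{u+1}\text{ and }0\le z_2<2^{u+2}\}$. Moreover, in both situations, $$h\diamond y=\sum_{i=0}^{h}\binom{h}{i}4^{i}k^{i}y\quad\text{and}\quad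 f_{f_0}(h,h')=\sum_{l=0}^{h-1}\binom{h}{l+1}4^{l}k^{l}f_0h'.$$ ($k\ne0$ and $a=-1-4k$) The set is $\{(z_1,2^{r-1}z_2+2^{\eta-1}z_1):0\le z_1,z_2<2\}$. Moreover, $$h\diamond y=(-1)^{h}\sum_{i=0}^{h}\binom{h}{i}4^{i}k^{i}y\quad\text{and}\quad f_{f_0}(h,h')=\sum_{l=0}^{h-1}A_{hl}4^{l}k^{l}f_0h',$$ where $A_{hl}:=\sum_{j=l}^{h-1}(-1)^{j}\binom{j}{l}$.
   Context: $\eta\ge1$ and $r$ are integers; set $p=2$ below. The trivial linear cycle set structure on $H$ is $i\cdot j:=j$. Elements $h,h'\in H$ are identified with their integer representatives in $\{0,\dots,2^{\eta}-1\}$; integers are viewed in $I$ through their classes, so each displayed set of pairs is a subset of $I\times I$. An action of $H$ on $I$ is a map $\diamond\colon H\times I\to I$ with $(h+h')\diamond y=h\diamond(h'\diamond y)$, $h\diamond(y+y')=h\diamond y+h\diamond y'$, $0\diamond y=y$. A 2-cocycle (for $\diamond$) is a pair $(\beta,f)$ of maps $H\times H\to I$, both vanishing when some argument is $0$, with $\beta$ symmetric, such that for all $a,b,c\in H$: $\beta(b,c)-\beta(a+b,c)+\beta(a,b+c)-\beta(a,b)=0$; $f(a,b+c)-f(a,b)-f(a,c)=a\diamond\beta(b,c)-\beta(b,c)$; $f(a+b,c)=b\diamond f(a,c)+f(b,c)$. It is a coboundary if there is $t\colon H\to I$ with $t(0)=0$, $\beta(a,b)=t(a)-t(a+b)+t(b)$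 and $f(a,b)=t(b)-a\diamond t(b)$ for all $a,b$. The quotient group of 2-cocycles modulo coboundaries is $\operatorname{H}^2_\diamond(H,I)$. For $\gamma\in I$ and $0\le i,j<2^{\eta}$: $\alpha_1(\gamma)(i,j):=\gamma$ if $i+j\ge 2^{\eta}$, and $0$ otherwise. For $f_0\in I$: $f_{f_0}(h,h'):=h'\sum_{j=0}^{h-1}(j\diamond f_0)$ for $0\le h,h'<2^{\eta}$. A set $\Lambda\subseteq I\times I$ ''parametrizes a complete family $(\alpha_1(\gamma),f_{f_0})$ of representatives of 2-cocycles modulo coboundaries'' if $(\alpha_1(\gamma),f_{f_0})$ is a 2-cocycle for each $(f_0,\gamma)\in\Lambda$ and each class in $\operatorname{H}^2_\diamond(H,I)$ contains $(\alpha_1(\gamma),f_{f_0})$ for exactly one $(f_0,\gamma)\in\Lambda$. *)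

(* Defs.v *)
From HB Require Import structures.
From mathcomp Require Import all_boot all_order all_algebra all_fingroup.

Set Implicit Arguments.
Unset Strict Implicit.
Unset Printing Implicit Defensive.

Import Order.TTheory GRing.Theory Num.Theory.
Local Open Scope ring_scope.

Record add_action (H I : finZmodType) := AddAction {
  act_fun :> H -> I -> I;
  act_addl : forall h h' y, act_fun (h + h') y = act_fun h (act_fun h' y);
  act_addr : forall h y y', act_fun h (y + y') = act_fun h y + act_fun h y';
  act_zero : forall y, act_fun 0 y = y
}.

Lemma act0r (H I : finZmodType) (act : add_action H I) h : act h 0 = 0.
Proof. by apply: (addrI (act h 0)); rewrite -act_addr !addr0. Qed.

Lemma actN (H I : finZmodType) (act : add_action H I) h y : act h (- y) = - act h y.
Proof. by apply: (addrI (act h y)); rewrite -act_addr !subrr act0r. Qed.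

(* Pairs (beta, f) of maps H x H -> I.  The group law, written
   multiplicatively in group_scope, is pointwise addition. *)
Definition cochain2 (H I : finZmodType) : Type :=
  ({ffun H * H -> I} * {ffun H * H -> I})%type.

HB.instance Definition _ (H I : finZmodType) := Finite.on (cochain2 H I).
HB.instance Definition _ (H I : finZmodType) := GRing.Zmodule.on (cochain2 H I).
HB.instance Definition _ (H I : finZmodType) :=
  [finGroupMixin of cochain2 H I for +%R].

Lemma cochain2_eq (H I : finZmodType) (c c' : cochain2 H I) :
  c.1 =1 c'.1 -> c.2 =1 c'.2 -> c = c'.
Proof. by case: c c' => [b f] [b' f'] /= /ffunP-> /ffunP->. Qed.

(* The equations below are those of 2-cocycles of H endowed with the trivial
   linear cycle set structure i . j := j. *)
Definition is_cocycle2 (H I : finZmodType) (act : add_action H I)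
    (c : cochain2 H I) : bool :=
  let beta := fun a b => c.1 (a, b) in
  let f := fun a b => c.2 (a, b) in
  [&& [forall a, [&& beta a 0 == 0, beta 0 a == 0, f a 0 == 0 & f 0 a == 0]],
      [forall a, forall b, beta a b == beta b a],
      [forall a, forall b, forall d,
         beta b d - beta (a + b) d + beta a (b + d) - beta a b == 0],
      [forall a, forall b, forall d,
         f a (b + d) - f a b - f a d == act a (beta b d) - beta b d] &
      [forall a, forall b, forall d,
         f (a + b) d == act b (f a d) + f b d]].

Definition coboundary2 (H I : finZmodType) (act : add_action H I)
    (t : {ffun H -> I}) : cochain2 H I :=
  ([ffun x => t x.1 - t (x.1 + x.2) + t x.2], [ffun x => t x.2 - act x.1 (t x.2)]).

Definition Z2_set (H I : finZmodType) (act : add_action H I) : {set cochain2 H I} :=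
  [set c | is_cocycle2 act c].

Definition B2_set (H I : finZmodType) (act : add_action H I) : {set cochain2 H I} :=
  [set coboundary2 act t | t : {ffun H -> I} & t 0 == 0].

Lemma is_cocycle2P (H I : finZmodType) (act : add_action H I) (c : cochain2 H I) :
  reflect
    [/\ forall a, [/\ c.1 (a, 0) = 0, c.1 (0, a) = 0, c.2 (a, 0) = 0 & c.2 (0, a) = 0],
        forall a b, c.1 (a, b) = c.1 (b, a),
        forall a b d, c.1 (b, d) - c.1 (a + b, d) + c.1 (a, b + d) - c.1 (a, b) = 0,
        forall a b d, c.2 (a, b + d) - c.2 (a, b) - c.2 (a, d)
                        = act a (c.1 (b, d)) - c.1 (b, d) &
        forall a b d, c.2 (a + b, d) = act b (c.2 (a, d)) + c.2 (b, d)]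
    (is_cocycle2 act c).
Proof.
apply: (iffP and5P) => [[/forallP h1 /forallP h2 /forallP h3 /forallP h4 /forallP h5]
                      | [h1 h2 h3 h4 h5]].
  split=> [a|a b|a b d|a b d|a b d].
  - by have /and4P[/eqP-> /eqP-> /eqP-> /eqP->] := h1 a.
  - exact/eqP/(forallP (h2 a)).
  - exact/eqP/(forallP (forallP (h3 a) b)).
  - exact/eqP/(forallP (forallP (h4 a) b)).
  - exact/eqP/(forallP (forallP (h5 a) b)).
split; apply/forallP=> a.
- by have [-> -> -> ->] := h1 a; rewrite eqxx.
- by apply/forallP=> b; apply/eqP.
- by do 2!apply/forallP=> ?; apply/eqP.
- by do 2!apply/forallP=> ?; apply/eqP.
- by do 2!apply/forallP=> ?; apply/eqP.
Qed.

Lemma Z2_group_set (H I : finZmodType) (act : add_action H I) :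
  group_set (Z2_set act).
Proof.
apply/group_setP; split.
  rewrite inE; apply/is_cocycle2P.
  by split=> [a|a b|a b d|a b d|a b d]; rewrite !ffunE ?act0r ?subrr ?addr0 ?subr0.
move=> c c'; rewrite !inE => /is_cocycle2P[u1 u2 u3 u4 u5] /is_cocycle2P[v1 v2 v3 v4 v5].
apply/is_cocycle2P; split=> [a|a b|a b d|a b d|a b d]; rewrite !ffunE.
- by have [-> -> -> ->] := u1 a; have [-> -> -> ->] := v1 a; rewrite addr0.
- by rewrite u2 v2.
- rewrite !opprD (addrACA (c.1 _)) (addrACA (c.1 _ - _)) (addrACA (c.1 _ - _ + _)).
  by rewrite u3 v3 addr0.
- rewrite act_addr !opprD (addrACA (c.2 _)) (addrACA (c.2 _ - _)) u4 v4.
  by rewrite [RHS]addrACA.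
- by rewrite act_addr addrACA u5 v5.
Qed.

Lemma B2_group_set (H I : finZmodType) (act : add_action H I) :
  group_set (B2_set act).
Proof.
apply/group_setP; split.
  apply/imsetP; exists 0; first by rewrite inE ffunE.
  apply: cochain2_eq => x; rewrite !ffunE ?act0r ?subrr ?addr0 //.
move=> _ _ /imsetP[t /[!inE] /eqP t0 ->] /imsetP[s /[!inE] /eqP s0 ->].
apply/imsetP; exists (t + s); first by rewrite inE ffunE t0 s0 addr0.
apply: cochain2_eq => x; rewrite !ffunE ?act_addr !opprD.
  by rewrite (addrACA (t x.1)) [RHS]addrACA.
by rewrite addrACA.
Qed.

Canonical Z2 (H I : finZmodType) (act : add_action H I) : {group cochain2 H I} :=
  Group (Z2_group_set act).

Canonical B2 (H I : finZmodType) (act : add_action H I) : {group cochain2 H I} :=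
  Group (B2_group_set act).

Lemma B2_sub_Z2 (H I : finZmodType) (act : add_action H I) : B2 act \subset Z2 act.
Proof.
apply/subsetP=> _ /imsetP[t /[!inE] /eqP t0 ->].
apply/is_cocycle2P; split=> [a|a b|a b d|a b d|a b d]; rewrite !ffunE /=.
- by rewrite t0 !addr0 !add0r act0r act_zero !subrr addNr oppr0.
- by rewrite (addrC b) addrAC [RHS]addrAC (addrC (t a)).
- rewrite (addrA a b) !opprD !opprK !addrA.
  rewrite [LHS](ACl ((1*12)*(9*2)*(3*6)*(11*4)*(5*8)*(7*10)))%AC /=.
  by rewrite !subrr !addr0.
- rewrite !act_addr !actN !opprD !opprK !addrA.
  by rewrite [RHS](ACl (5*2*4*1*6*3))%AC.
- by rewrite act_addr actN (addrC a) act_addl [RHS]addrC addrA subrK.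
Qed.

Definition H2 (H I : finZmodType) (act : add_action H I) : {group coset_of (B2 act)} :=
  (Z2 act / B2 act)%G.

(* 'Z_n is Z/n only for n > 1; its elements coerce to their representatives in
   {0, .., n-1}, so that n <= x.1 + x.2 compares natural numbers. *)
Definition alpha1 (n : nat) (I : finZmodType) (gamma : I) : {ffun 'Z_n * 'Z_n -> I} :=
  [ffun x : 'Z_n * 'Z_n => if (n <= x.1 + x.2)%N then gamma else 0].

Definition f_of (n : nat) (I : finZmodType) (act : add_action 'Z_n I) (f0 : I) :
    {ffun 'Z_n * 'Z_n -> I} :=
  [ffun x : 'Z_n * 'Z_n => (\sum_(j < (x.1 : nat)) act j%:R f0) *+ x.2].

Definition cochain_of (n : nat) (I : finZmodType) (act : add_action 'Z_n I)
    (p : I * I) : cochain2 'Z_n I :=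
  (alpha1 n p.2, f_of act p.1).

Definition complete_family (n : nat) (I : finZmodType) (act : add_action 'Z_n I)
    (Lambda : {set I * I}) : Prop :=
  (forall p, p \in Lambda -> cochain_of act p \in Z2 act) /\
  (forall C, C \in H2 act ->
     exists! p : I * I, p \in Lambda /\ cochain_of act p \in (C : {set _})).

Definition is_pm_power_action (eta r : nat) (act : add_action 'Z_(2 ^ eta) 'Z_(2 ^ r))
    (a : int) (k : nat) : Prop :=
  [/\ (k < 2 ^ (r - 2))%N,
      a = (1 + 4 * k)%N%:Z \/ a = - (1 + 4 * k)%N%:Z &
      forall (h : 'Z_(2 ^ eta)) (y : 'Z_(2 ^ r)), act h y = (a ^+ h)%:~R * y].

Definition A_coef (h l : nat) : int := \sum_(l <= j < h) (-1) ^+ j * 'C(j, l)%:Z.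

(* Main.v *)
(* Every 2-cocycle is cohomologous to one of the form (alpha1 gamma, f_{f0}): a
   map t whose increments are -beta(h, 1) trivialises beta except for the carry.
   Such a pair is a 2-cocycle iff S f0 = 0 and 2^eta f0 + (a - 1) gamma = 0,
   where S is the sum of the a^j for j < 2^eta, and it is a coboundary iff
   (f0, gamma) = ((1 - a) t, 2^eta t) for some t.  What remains is arithmetic in
   Z/2^r.  Doubling the number of terms multiplies S by 1 + a^(2^e), so S is
   2^eta times a unit if a = 1 + 4k, and 0 if a = -(1 + 4k).  In the latter case
   1 - a is 2 times a unit w with 2^eta w = 2^eta, so both subgroups are those of
   a = -1. *)

Require Import Defs.
From mathcomp Require Import all_boot all_order all_algebra all_fingroup.
From mathcomp Require Import zify ring.

Set Implicit Arguments.
Unset Strict Implicit.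
Unset Printing Implicit Defensive.

Import Order.TTheory GRing.Theory Num.Theory.
Local Open Scope ring_scope.

(** * Representatives of classes modulo [n] and their carries *)

Lemma ltn_Zp n (x : 'Z_n) : (1 < n)%N -> (x < n)%N.
Proof. by move=> n1; rewrite -[ltnRHS](Zp_cast n1). Qed.

Lemma val_ZpD n (x y : 'Z_n) : (1 < n)%N ->
  (x + y : 'Z_n) = (if (n <= x + y)%N then x + y - n else x + y)%N :> nat.
Proof.
move=> n1; have := ltn_Zp x n1; have := ltn_Zp y n1.
case: n x y n1 => [|[|n]] // x y _ yn xn.
rewrite [LHS]/=; move: (nat_of_ord x) (nat_of_ord y) xn yn => i j i_lt j_lt.
have [le_n|lt_n] := leqP n.+2 (i + j); last exact: modn_small.
rewrite -[in LHS](subnK le_n) modnDr modn_small //; lia.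
Qed.

(** The length [h] is a natural number and not a class, so that [h = n] gives the sum over a full
    period. *)
Definition partial_sum n (I : finZmodType) (act : add_action 'Z_n I) (f0 : I)
    (h : nat) : I :=
  \sum_(j < h) act j%:R f0.

(* In the next two definitions a pair [p] stands for [(f0, gamma)]. *)
Definition normal_cocycle n (I : finZmodType) (act : add_action 'Z_n I)
    (p : I * I) : Prop :=
  partial_sum act p.1 n = 0 /\ act 1 p.2 - p.2 = - (p.1 *+ n).

Definition normal_coboundary n (I : finZmodType) (act : add_action 'Z_n I)
    (t : I) : I * I :=
  (t - act 1 t, t *+ n).

(** * Cocycles in normal form and their classes *)

Section Normalization.

Variables (n : nat) (I : finZmodType) (act : add_action 'Z_n I).
Hypothesis n_gt1 : (1 < n)%N.

Lemma Zp_natn : n%:R = 0 :> 'Z_n.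
Proof. exact: pchar_Zp. Qed.

Lemma actMn (h : 'Z_n) y m : act h (y *+ m) = act h y *+ m.
Proof. by elim: m => [|m IHm]; rewrite ?act0r // !mulrS act_addr IHm. Qed.

Lemma act_sum (h : 'Z_n) m (F : 'I_m -> I) :
  act h (\sum_(j < m) F j) = \sum_(j < m) act h (F j).
Proof.
by elim/big_rec2: _ => [|j x y _ <-]; rewrite ?act0r // act_addr.
Qed.

(** The crossed homomorphism law: the terms after the first [h'] are those of the sum of length [h],
    moved by [h']. *)
Lemma partial_sumD f0 h h' :
  partial_sum act f0 (h + h') =
    act h'%:R (partial_sum act f0 h) + partial_sum act f0 h'.
Proof.
rewrite /partial_sum addnC big_split_ord /= addrC act_sum; congr (_ + _).
by apply: eq_bigr => j _; rewrite natrD act_addl.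
Qed.

(** A carry drops a full period of [n] terms, whose sum is zero, so the crossed homomorphism law
    descends to ['Z_n]. *)
Lemma partial_sum_Zp f0 (h h' : 'Z_n) : partial_sum act f0 n = 0 ->
  partial_sum act f0 (h + h')%R =
    act h' (partial_sum act f0 h) + partial_sum act f0 h'.
Proof.
move=> f0n; rewrite -[in act h' _](natr_Zp h') -partial_sumD val_ZpD //.
case: leqP => // le_n.
by rewrite -{2}(subnK le_n) partial_sumD f0n Zp_natn act_zero addr0.
Qed.

Lemma act_diff f0 gamma (h : nat) : act 1 gamma - gamma = - (f0 *+ n) ->
  act h%:R gamma - gamma = - (partial_sum act f0 h *+ n).
Proof.
move=> g1; elim: h => [|h IHh].
  by rewrite act_zero subrr /partial_sum big_ord0 mul0rn oppr0.
rewrite -[h.+1]add1n partial_sumD natrD (addrC 1%:R) act_addl.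
rewrite -[act 1%:R gamma](subrK gamma) g1 act_addr actN actMn -addrA IHh.
by rewrite [partial_sum act f0 1]big_ord1 act_zero mulrnDl opprD.
Qed.

Lemma cochain_of1E p a b :
  (cochain_of act p).1 (a, b) = if (n <= a + b)%N then p.2 else 0.
Proof. by rewrite ffunE. Qed.

Lemma cochain_of2E p a b :
  (cochain_of act p).2 (a, b) = partial_sum act p.1 a *+ b.
Proof. by rewrite ffunE. Qed.

(** The first condition gives the crossed homomorphism law in the first argument. The second,
    extended by [act_diff] from 1 to every [a], accounts for the [n] copies of the partial sum lost
    at a carry in the second argument. *)
Lemma normal_cocycle_Z2 p : normal_cocycle act p -> cochain_of act p \in Z2 act.
Proof.
case: p => f0 gamma [/= f0n g1]; rewrite inE; apply/is_cocycle2P.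
split=> [a|a b|a b d|a b d|a b d]; rewrite ?cochain_of1E ?cochain_of2E /fst.
- have an := ltn_Zp a n_gt1.
  by rewrite addn0 add0n leqNgt an /= mulr0n [partial_sum _ _ 0]big_ord0 mul0rn.
- by rewrite addnC.
- have := ltn_Zp a n_gt1; have := ltn_Zp b n_gt1; have := ltn_Zp d n_gt1.
  rewrite !val_ZpD //.
  move: (nat_of_ord a) (nat_of_ord b) (nat_of_ord d) => x y z zn yn xn.
  (* Both groupings of [x + y + z] produce the same number of carries; [lia] refutes the
     inconsistent combinations. *)
  case: (leqP n (y + z)); case: (leqP n (x + y)) => xy yz;
    (case: leqP => h1; case: leqP => h2);
    rewrite ?(subrr, add0r, subr0, addr0, addNr, oppr0) //; lia.
- rewrite !val_ZpD //.
  case: leqP => h; last by rewrite act0r mulrnDr subr0 addrAC addrK subrr.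
  rewrite -[in act a _](natr_Zp a) (act_diff _ g1) // mulrnBr // mulrnDr.
  by rewrite -[LHS]addrA -opprD addrAC subrr sub0r.
- by rewrite partial_sum_Zp // mulrnDl actMn.
Qed.

Lemma val_Zp1 : (1 : 'Z_n) = 1%N :> nat.
Proof. by []. Qed.

Lemma val_Zp_small h : (h < n)%N -> (h%:R : 'Z_n) = h :> nat.
Proof. by move=> h_lt; rewrite val_Zp_nat // modn_small. Qed.

Lemma Zp_pred1 : n.-1%:R + 1 = 0 :> 'Z_n.
Proof. by rewrite -mulrSr prednK ?Zp_natn //; lia. Qed.

Lemma partial_sum0 f0 : partial_sum act f0 0 = 0.
Proof. exact: big_ord0. Qed.

Lemma partial_sum1 f0 : partial_sum act f0 1 = f0.
Proof. by rewrite /partial_sum big_ord1 act_zero. Qed.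

(** The two conditions are cocycle equations at triples that just wrap around: the last equation at
    [(n - 1, 1, 1)] and the one before it at [(1, n - 1, 1)]. *)
Lemma Z2_normal_cocycle p : cochain_of act p \in Z2 act -> normal_cocycle act p.
Proof.
rewrite inE => /is_cocycle2P [_ _ _ h4 h5]; split.
  have := h5 n.-1%:R 1 1; rewrite Zp_pred1 !cochain_of2E val_Zp1 !mulr1n.
  rewrite partial_sum0 val_Zp_small; last by lia.
  have -> : 1 = 1%:R :> 'Z_n by [].
  by rewrite -partial_sumD addn1 prednK //; lia.
have := h4 1 n.-1%:R 1.
rewrite Zp_pred1 !cochain_of2E cochain_of1E val_Zp1 partial_sum1.
rewrite val_Zp_small; last by lia.
have n1 : (n.-1 + 1 = n)%N by lia.
by rewrite n1 leqnn sub0r -opprD -mulrnDr n1 => <-.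
Qed.

(** With one argument equal to 1 the cocycle equations are recursions: they rebuild [c.1] from its
    values at [(h, 1)] and, these being zero before the carry, [c.2] from its value at [(1, 1)]. *)
Lemma Z2_normal_form c : c \in Z2 act ->
    (forall h : 'Z_n, (h.+1 < n)%N -> c.1 (h, 1) = 0) ->
  c = cochain_of act (c.2 (1, 1), c.1 (n.-1%:R, 1)).
Proof.
rewrite inE => /is_cocycle2P [h1 h2 h3 h4 h5] c0.
(* Passing from [b] to [b + 1] adds [c.1 (a + b, 1)], which can be nonzero only if [a + b] is
   [n - 1]: the value enters at the carry and stays. *)
have c1E a b : (b < n)%N ->
    c.1 (a, b%:R) = if (n <= a + b)%N then c.1 (n.-1%:R, 1) else 0.
  elim: b => [|b IHb] b_lt.
    by have [-> _ _ _] := h1 a; rewrite addn0 leqNgt ltn_Zp.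
  have cb : c.1 (b%:R, 1) = 0 by rewrite c0 // val_Zp_small // ltnW.
  have := h3 a b%:R 1; rewrite cb sub0r.
  rewrite -[b%:R + 1]mulrSr IHb; last exact: ltnW.
  move=> /eqP; rewrite subr_eq0 addrC subr_eq => /eqP->.
  have a_lt := ltn_Zp a n_gt1.
  have sE : (a + b%:R)%R = (if (n <= a + b)%N then a + b - n else a + b)%N :> nat.
    by rewrite val_ZpD // val_Zp_small // ltnW.
  case: (leqP n (a + b)) sE => ab sE.
    have -> : c.1 (a + b%:R, 1) = 0 by apply: c0; rewrite sE; lia.
    by rewrite addr0 ifT //; lia.
  rewrite add0r; case: leqP => ab1; last by apply: c0; rewrite sE; lia.
  congr (c.1 (_, 1)); apply: val_inj => /=; rewrite [LHS]sE val_Zp_small; lia.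
have c2S a b : (b < n)%N -> c.2 (a, b%:R) = c.2 (a, 1) *+ b.
  elim: b => [|b IHb] b_lt; first by have [_ _ -> _] := h1 a.
  have cb : c.1 (b%:R, 1) = 0 by rewrite c0 // val_Zp_small // ltnW.
  have := h4 a b%:R 1; rewrite cb act0r subrr.
  rewrite -[b%:R + 1]mulrSr IHb 1?ltnW // => /eqP.
  by rewrite -addrA -opprD subr_eq0 -mulrSr => /eqP.
have c2P a : c.2 (a%:R, 1) = partial_sum act (c.2 (1, 1)) a.
  elim: a => [|a IHa]; first by rewrite partial_sum0; have [_ _ _ ->] := h1 1.
  by rewrite mulrSr h5 IHa -[a.+1]addn1 partial_sumD partial_sum1.
apply: cochain2_eq => -[a b].
  by rewrite cochain_of1E -[in LHS](natr_Zp b) c1E // ltn_Zp.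
by rewrite cochain_of2E -[in LHS](natr_Zp b) c2S ?ltn_Zp // -[in LHS](natr_Zp a) c2P.
Qed.

(** The increments of [t] cancel [c.1 (h, 1)]; what remains is [- t 1 = c.1 (0, 1)], which is zero
    when [c] is a cocycle. *)
Lemma Z2_reduction (c : cochain2 'Z_n I) : exists2 t : {ffun 'Z_n -> I}, t 0 = 0 &
  forall h : 'Z_n, (h.+1 < n)%N ->
    (c - coboundary2 act t).1 (h, 1) = c.1 (0, 1).
Proof.
exists [ffun h : 'Z_n => - \sum_(i < h) c.1 (i%:R, 1)].
  by rewrite ffunE big_ord0 oppr0.
move=> h h_lt; rewrite !ffunE.
have -> : (h + 1)%R = h.+1 :> nat by rewrite val_ZpD // val_Zp1 addn1 leqNgt h_lt.
rewrite big_ord_recr /= big_ord1 natr_Zp opprK addrA addNr add0r.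
by rewrite opprB addrC subrK.
Qed.

Lemma partial_sumDr f0 f1 h :
  partial_sum act (f0 + f1) h = partial_sum act f0 h + partial_sum act f1 h.
Proof.
by rewrite /partial_sum -big_split; apply: eq_bigr => j _; rewrite act_addr.
Qed.

Lemma partial_sum_telescope t h :
  partial_sum act (t - act 1 t) h = t - act h%:R t.
Proof.
elim: h => [|h IHh]; first by rewrite partial_sum0 act_zero subrr.
rewrite /partial_sum big_ord_recr -/(partial_sum _ _ _) IHh /=.
by rewrite act_addr actN -act_addl -mulrSr addrA subrK.
Qed.

Lemma cochainB1 (c d : cochain2 'Z_n I) x : (c - d).1 x = c.1 x - d.1 x.
Proof. by rewrite !ffunE. Qed.

Lemma cochainB2 (c d : cochain2 'Z_n I) x : (c - d).2 x = c.2 x - d.2 x.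
Proof. by rewrite !ffunE. Qed.

(** Where no carry occurs the first components vanish, which forces [t h] to be [h] times [t 1];
    only [t 1] is left to choose. *)
Lemma sub_B2P p q :
  cochain_of act p - cochain_of act q \in B2 act <->
  exists t, p = q + normal_coboundary act t.
Proof.
split=> [/imsetP[t /[!inE] /eqP t0 pqt]|[t ->]].
  have p1 a b : (cochain_of act p).1 (a, b) - (cochain_of act q).1 (a, b) =
      t a - t (a + b) + t b.
    by rewrite -cochainB1 pqt !ffunE.
  have p2 a b : (cochain_of act p).2 (a, b) - (cochain_of act q).2 (a, b) =
      t b - act a (t b).
    by rewrite -cochainB2 pqt !ffunE.
  have tE h : (h < n)%N -> t h%:R = t 1 *+ h.
    elim: h => [|h IHh] h_lt //; have h_lt' := ltnW h_lt.
    have := p1 h%:R 1.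
    rewrite !cochain_of1E val_Zp_small // val_Zp1 addn1 leqNgt h_lt subrr.
    move=> /esym/eqP; rewrite -[h%:R + 1]mulrSr addrAC subr_eq0 IHh //.
    by rewrite -mulrSr => /eqP.
  exists (t 1); apply/eqP; rewrite addrC -subr_eq; apply/eqP.
  have := p2 1 1; have := p1 n.-1%:R 1; rewrite !cochain_of1E !cochain_of2E Zp_pred1 t0.
  rewrite val_Zp1 !partial_sum1 !mulr1n tE ?val_Zp_small; try lia.
  rewrite addn1 subr0 -mulrSr prednK ?leqnn; last exact: ltnW.
  by rewrite /normal_coboundary; case: p q {pqt p1 p2} => [? ?] [? ?] /= <- <-.
(* Multiplication by representatives fails to be additive by exactly [t *+ n] at a carry. *)
apply/imsetP; exists [ffun h : 'Z_n => t *+ h]; first by rewrite inE ffunE.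
apply: cochain2_eq => -[a b].
  rewrite cochainB1.
  rewrite !cochain_of1E !ffunE /fst /snd val_ZpD //.
  case: leqP => h; last by rewrite subrr mulrnDr opprD addrA subrr add0r addNr.
  rewrite mulrnBr // mulrnDr [LHS]addrC addKr opprB.
  by rewrite [RHS]addrAC [RHS]addrC subrK.
rewrite cochainB2.
rewrite !cochain_of2E partial_sumDr partial_sum_telescope natr_Zp.
by rewrite mulrnDl addrAC subrr add0r !ffunE mulrnBl actMn.
Qed.

End Normalization.

(** Each class contains a normalized cocycle [d], so classes of cocycles become classes of pairs
    modulo normal coboundaries. *)
Lemma complete_familyP n (I : finZmodType) (act : add_action 'Z_n I)
    (Lambda : {set I * I}) : (1 < n)%N ->
    (forall p, p \in Lambda -> normal_cocycle act p) ->
    (forall p, normal_cocycle act p -> exists! q : I * I,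
       q \in Lambda /\ exists t, p = q + normal_coboundary act t) ->
  complete_family act Lambda.
Proof.
move=> n_gt1 Lambda_cocycle Lambda_repr; split=> [p /Lambda_cocycle|C].
  exact: normal_cocycle_Z2.
case/morphimP=> c Nc Zc ->.
have [t t0 c1] := Z2_reduction act n_gt1 c.
pose d := c - coboundary2 act t.
have Bt : coboundary2 act t \in B2 act by apply/imsetP; exists t; rewrite ?inE ?t0.
have Zd : d \in Z2 act.
  by rewrite (groupM Zc) // groupV (subsetP (B2_sub_Z2 act)).
have dE : d = cochain_of act (d.2 (1, 1), d.1 (n.-1%:R, 1)).
  apply: Z2_normal_form => // h h_lt; rewrite c1 //.
  by move: Zc; rewrite inE => /is_cocycle2P[/(_ 1)[]].
set p := (_, _) in dE.
have [|q [[qL qp] q_uniq]] := Lambda_repr p.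
  by apply: Z2_normal_cocycle => //; rewrite -dE.
have memC q' : cochain_of act q' \in (coset (B2 act) c : {set _}) <->
    exists t, p = q' + normal_coboundary act t.
  rewrite val_coset // mem_rcoset -sub_B2P // -dE.
  have -> : (cochain_of act q' * c^-1)%g =
      ((d - cochain_of act q')^-1 * (coboundary2 act t)^-1)%g.
    change (cochain_of act q' - c = - (d - cochain_of act q') - coboundary2 act t).
    by rewrite /d opprB opprB addrA addrAC addrK.
  by rewrite groupMr groupV.
exists q; split=> [|q' [q'L /memC q'p]]; first by split=> //; apply/memC.
by apply: q_uniq.
Qed.

(** * Divisibility and units modulo a power of 2 *)

Lemma Zp_natr_eq (n i j : nat) : (1 < n)%N ->
  (i%:R = j%:R :> 'Z_n) <-> (i = j %[mod n])%N.
Proof.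
move=> n1; split=> [/(congr1 (@nat_of_ord _))|ij]; first by rewrite !val_Zp_nat.
by apply: val_inj; rewrite /= !val_Zp_nat.
Qed.

Section Zpow2.

Variable r : nat.
Hypothesis r_gt0 : (0 < r)%N.
Local Notation R := 'Z_(2 ^ r).

Lemma pow2_gt1 : (1 < 2 ^ r)%N.
Proof. by rewrite -{1}(expn0 2) ltn_exp2l. Qed.

Lemma Zp_pow2_ge e : (r <= e)%N -> 2 ^+ e = 0 :> R.
Proof.
by move=> re; rewrite -(subnK re) exprD -[in X in _ * X]natrX pchar_Zp ?mulr0 // pow2_gt1.
Qed.

Lemma Zp_pow2_mul_eq0 e (x : R) : (e <= r)%N -> 2 ^+ e * x = 0 ->
  exists y, x = 2 ^+ (r - e) * y.
Proof.
move=> er; rewrite -(natr_Zp x) -natrX -natrM => /(Zp_natr_eq _ 0 pow2_gt1).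
rewrite mod0n => /eqP; rewrite -/(dvdn _ _) -{1}(subnKC er) expnD.
rewrite dvdn_pmul2l ?expn_gt0 // => /dvdnP[y ->].
by exists y%:R; rewrite natrM natrX mulrC.
Qed.

Lemma Zp_pow2_div e (x : R) : exists (z : 'I_(2 ^ e)) (t : R), x = z%:R + 2 ^+ e * t.
Proof.
have e_gt0 : (0 < 2 ^ e)%N by rewrite expn_gt0.
exists (Ordinal (ltn_pmod x e_gt0)), (x %/ 2 ^ e)%:R.
by rewrite /= -natrX -natrM -natrD addnC mulnC -divn_eq natr_Zp.
Qed.

(** Since [e <= r], reduction modulo [2 ^ e] is well defined on [R] and kills the last term. With
    [Zp_pow2_div], the numbers below [2 ^ e] form a transversal of the multiples of [2 ^ e]. *)
Lemma Zp_pow2_rem_inj e (z z' : 'I_(2 ^ e)) (t : R) : (e <= r)%N ->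
  z%:R = z'%:R + 2 ^+ e * t -> z = z'.
Proof.
move=> er; rewrite -(natr_Zp t) -natrX -natrM -natrD => /(Zp_natr_eq _ _ pow2_gt1).
move=> /(congr1 (modn^~ (2 ^ e)%N)).
by rewrite !modn_dvdm ?dvdn_exp2l // addnC mulnC modnMDl !modn_small // => /val_inj.
Qed.

Lemma Zp_pow2_unit (x : R) : 1 + 2 * x \is a GRing.unit.
Proof.
rewrite -(natr_Zp x) -natrM -(natrD _ 1) unitZpE ?pow2_gt1 //.
by rewrite coprime_pexpl // coprime2n oddD mul2n odd_double.
Qed.

End Zpow2.

(** * Geometric sums with [2 ^ e] terms *)

Section Geometric.
Variable R : comNzRingType.

Lemma sum_pow2S (x : R) e :
  \sum_(j < 2 ^ e.+1) x ^+ j = (\sum_(j < 2 ^ e) x ^+ j) * (1 + x ^+ (2 ^ e)).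
Proof.
rewrite expnS mul2n -addnn big_split_ord /= mulrDr mulr1 mulr_suml; congr (_ + _).
by apply: eq_bigr => j _; rewrite -exprD addnC.
Qed.

Lemma expr_1D4 (k : R) n : exists k', (1 + 4 * k) ^+ n = 1 + 4 * k'.
Proof.
elim: n => [|n [k' IHn]]; first by exists 0; rewrite mulr0 addr0.
by exists (k + k' + 4 * k * k'); rewrite exprS IHn; ring.
Qed.

(** Each doubling multiplies by [1 + (1 + 4 * k')], which is 2 times a factor of the form
    [1 + 2 * k']. *)
Lemma sum_expr_1D4 (k : R) e : exists y,
  \sum_(j < 2 ^ e) (1 + 4 * k) ^+ j = 2 ^+ e * (1 + 2 * y).
Proof.
elim: e => [|e [y IHe]].
  by exists 0; rewrite big_ord1 !expr0 mulr0 addr0 mulr1.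
have [k' k'E] := expr_1D4 k (2 ^ e).
by exists (y + k' + 2 * y * k'); rewrite sum_pow2S IHe k'E exprS; ring.
Qed.

(** The shortest sum is already [- 4 * k]. From then on the exponents [2 ^ e.+1] are even, the sign
    disappears, and each doubling brings one more factor 2. *)
Lemma sum_expr_N1D4 (k : R) e : exists y,
  \sum_(j < 2 ^ e.+1) (- (1 + 4 * k)) ^+ j = 2 ^+ e.+2 * y.
Proof.
elim: e => [|e [y IHe]].
  by exists (- k); rewrite 2!big_ord_recl big_ord0 /= !expr0 !expr1; ring.
have [k' k'E] := expr_1D4 k (2 ^ e.+1).
exists (y * (1 + 2 * k')); rewrite sum_pow2S IHe.
rewrite exprNn expnS mul2n -signr_odd odd_double expr0 mul1r -mul2n -expnS k'E.
by rewrite [in RHS]exprS; ring.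
Qed.

End Geometric.

(** * Complete families when [h] acts as multiplication by [c ^ h] *)

Section PowerAction.

Variables (eta r : nat) (act : add_action 'Z_(2 ^ eta) 'Z_(2 ^ r)) (c : 'Z_(2 ^ r)).
Hypotheses (eta_gt0 : (0 < eta)%N) (r_gt0 : (0 < r)%N).
Hypothesis actE : forall h y, act h y = c ^+ h * y.

Let n_gt1 : (1 < 2 ^ eta)%N := pow2_gt1 eta_gt0.

Lemma partial_sum_power f0 h : (h <= 2 ^ eta)%N ->
  partial_sum act f0 h = (\sum_(j < h) c ^+ j) * f0.
Proof.
move=> h_le; rewrite /partial_sum mulr_suml; apply: eq_bigr => j _.
by rewrite actE val_Zp_small // (leq_trans _ h_le).
Qed.

Lemma complete_family_power (Lambda : {set 'Z_(2 ^ r) * 'Z_(2 ^ r)}) :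
    (forall p, p \in Lambda ->
       (\sum_(j < 2 ^ eta) c ^+ j) * p.1 = 0 /\ (c - 1) * p.2 = - (2 ^+ eta * p.1)) ->
    (forall f0 gamma, (\sum_(j < 2 ^ eta) c ^+ j) * f0 = 0 ->
       (c - 1) * gamma = - (2 ^+ eta * f0) ->
       exists2 q, q \in Lambda &
         exists t, f0 = q.1 + (1 - c) * t /\ gamma = q.2 + 2 ^+ eta * t) ->
    (forall q q' t, q \in Lambda -> q' \in Lambda ->
       q.1 = q'.1 + (1 - c) * t -> q.2 = q'.2 + 2 ^+ eta * t -> q = q') ->
  complete_family act Lambda.
Proof.
move=> LambdaZ LambdaE LambdaU.
have coboundaryE t : normal_coboundary act t = ((1 - c) * t, 2 ^+ eta * t).
  rewrite /normal_coboundary actE val_Zp1 // expr1 mulrBl mul1r.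
  by rewrite -[t *+ _]mulr_natl natrX.
have cocycleE p : normal_cocycle act p <->
    (\sum_(j < 2 ^ eta) c ^+ j) * p.1 = 0 /\ (c - 1) * p.2 = - (2 ^+ eta * p.1).
  rewrite /normal_cocycle partial_sum_power // actE val_Zp1 // expr1 mulrBl mul1r.
  by rewrite -[p.1 *+ _]mulr_natl natrX.
apply: complete_familyP => // [p /LambdaZ /cocycleE //|p /cocycleE[p1 p2]].
have [q qL [t [q1 q2]]] := LambdaE _ _ p1 p2.
exists q; split=> [|q' [q'L [t' pE]]].
  split=> //; exists t; rewrite coboundaryE.
  by case: p q {p1 p2 qL} q1 q2 => ? ? [? ?] /= -> ->.
move: pE q1 q2; rewrite coboundaryE => -> /= q1 q2; apply: (LambdaU _ _ (t' - t)) => //.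
  by apply/eqP; rewrite mulrBr addrA eq_sym subr_eq -q1.
by apply/eqP; rewrite mulrBr addrA eq_sym subr_eq -q2.
Qed.

(** As [2 ^ eta = 0] too, every pair is a cocycle and every coboundary is zero: each pair is alone
    in its class. *)
Lemma complete_family_trivial_le : c = 1 -> (r <= eta)%N ->
  complete_family act [set (z1%:R, z2%:R) | z1 : 'I_(2 ^ r), z2 : 'I_(2 ^ r)].
Proof.
move=> c1 r_le_eta; have eta0 := Zp_pow2_ge r_gt0 r_le_eta.
apply: complete_family_power => [_ /imset2P[z1 z2 _ _ ->]|f0 gamma _ _|q q' t _ _].
- rewrite c1 eta0 subrr !mul0r oppr0; split=> //.
  under eq_bigr do rewrite expr1n.
  by rewrite sumr_const card_ord natrX eta0 mul0r.
- exists (f0, gamma); last by exists 0; rewrite !mulr0 !addr0.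
  have lt_r (x : 'Z_(2 ^ r)) : (x < 2 ^ r)%N by apply: ltn_Zp; apply: pow2_gt1.
  apply/imset2P; exists (Ordinal (lt_r f0)) (Ordinal (lt_r gamma)) => //.
  by rewrite //= !natr_Zp.
- by rewrite c1 eta0 subrr !mul0r !addr0; case: q q' => ? ? [? ?] /= -> ->.
Qed.

(** Here [2 ^ eta] is the nonzero element killed by 2: cocycles are the pairs with [f0] even, and
    coboundaries shift [gamma] by multiples of [2 ^ eta]. *)
Lemma complete_family_trivial_eq : c = 1 -> r = eta.+1 ->
  complete_family act
    [set ((2 * z1)%N%:R, z2%:R) | z1 : 'I_(2 ^ (r - 1)), z2 : 'I_(2 ^ (r - 1))].
Proof.
move=> c1 rE; have r1 : (r - 1 = eta)%N by rewrite rE subn1.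
have eta1 : 2 * 2 ^+ eta = 0 :> 'Z_(2 ^ r) by rewrite -exprS Zp_pow2_ge // rE.
have rB : (r - eta = 1)%N by lia.
have sumE : \sum_(j < 2 ^ eta) c ^+ j = 2 ^+ eta.
  rewrite c1; under eq_bigr do rewrite expr1n.
  by rewrite sumr_const card_ord natrX.
rewrite r1; apply: complete_family_power; rewrite ?sumE c1 subrr.
- move=> _ /imset2P[z1 z2 _ _ ->] /=; rewrite mul0r natrM mulrA [_ * 2]mulrC eta1.
  by rewrite mul0r oppr0.
- move=> f0 gamma f0_eq _.
  have [y ->] := Zp_pow2_mul_eq0 r_gt0 (leq_trans (leqnSn _) (eq_leq (esym rE))) f0_eq.
  have [z1 [t1 ->]] := Zp_pow2_div eta y; have [z2 [t2 ->]] := Zp_pow2_div eta gamma.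
  exists ((2 * z1)%N%:R, z2%:R); first by apply/imset2P; exists z1 z2.
  exists t2; split=> //=; rewrite rB expr1 mul0r addr0 mulrDr mulrA eta1.
  by rewrite mul0r addr0 natrM.
- move=> _ _ t /imset2P[z1 z2 _ _ ->] /imset2P[z1' z2' _ _ ->] /=.
  rewrite mul0r addr0 => -> /Zp_pow2_rem_inj -> //; by rewrite rE.
Qed.

(* In the notation of the theorem, [v = u + 2] and [w] is the class of [s]. *)
Section PlusCase.

Variables (k w : 'Z_(2 ^ r)) (v : nat).
Hypotheses (w_unit : w \is a GRing.unit) (v_lt : (v < r)%N).
Hypotheses (ck : c = 1 + 4 * k) (kE : 4 * k = 2 ^+ v * w).

Let cB1 : c - 1 = 2 ^+ v * w.
Proof. by rewrite ck addrC addKr kE. Qed.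

Let cB1' : 1 - c = - (2 ^+ v * w).
Proof. by rewrite -cB1 opprB. Qed.

Lemma sum_plus_eq0 f0 :
  (\sum_(j < 2 ^ eta) c ^+ j) * f0 = 0 <-> 2 ^+ eta * f0 = 0.
Proof.
rewrite ck; have [y ->] := sum_expr_1D4 k eta.
split=> [|f0_eq]; last by rewrite mulrAC f0_eq mul0r.
by rewrite mulrAC => /(canRL (mulrK (Zp_pow2_unit r_gt0 y))); rewrite mul0r.
Qed.

Lemma plus_mul_eq0 gamma : 2 ^+ v * w * gamma = 0 ->
  exists y, gamma = 2 ^+ (r - v) * y.
Proof.
rewrite mulrAC => /(canRL (mulrK w_unit)); rewrite mul0r.
by apply: Zp_pow2_mul_eq0 => //; apply: ltnW.
Qed.

Lemma plus_mul_pow2 y : 2 ^+ v * w * (2 ^+ (r - v) * y) = 0.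
Proof.
have -> : 2 ^+ v * w * (2 ^+ (r - v) * y) = 2 ^+ v * 2 ^+ (r - v) * (w * y) by ring.
by rewrite -exprD subnKC ?Zp_pow2_ge ?mul0r // ltnW.
Qed.

(** As [2 ^ eta = 0], the coordinates decouple: [f0] is free and counts modulo [1 - c], that is
    modulo [2 ^ v], while [gamma] must be killed by [2 ^ v]. *)
Lemma complete_family_plus_le : (r <= eta)%N ->
  complete_family act
    [set (z1%:R, (2 ^ (r - v) * z2)%N%:R) | z1 : 'I_(2 ^ v), z2 : 'I_(2 ^ v)].
Proof.
move=> r_le_eta; have eta0 := Zp_pow2_ge r_gt0 r_le_eta.
apply: complete_family_power.
- move=> _ /imset2P[z1 z2 _ _ ->] /=; rewrite sum_plus_eq0 eta0 !mul0r oppr0.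
  by rewrite cB1 natrM natrX plus_mul_pow2.
- move=> f0 gamma _; rewrite eta0 mul0r oppr0 cB1.
  move=> /plus_mul_eq0[y ->].
  have [z1 [t1 ->]] := Zp_pow2_div v f0; have [z2 [t2 ->]] := Zp_pow2_div v y.
  exists (z1%:R, (2 ^ (r - v) * z2)%N%:R); first by apply/imset2P; exists z1 z2.
  (* This solves [(1 - c) * t = 2 ^+ v * t1]. *)
  exists (- (w^-1 * t1)); rewrite mul0r addr0 /=; split.
    by rewrite cB1' mulrN mulNr opprK mulrA mulrK.
  rewrite mulrDr mulrA -exprD (subnK (ltnW v_lt)).
  by rewrite (Zp_pow2_ge r_gt0 (leqnn r)) mul0r addr0 natrM natrX.
- move=> _ _ t /imset2P[z1 z2 _ _ ->] /imset2P[z1' z2' _ _ ->] /=.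
  rewrite cB1' mulNr -mulrN -mulrA => /Zp_pow2_rem_inj -> //; last exact: ltnW.
  by rewrite eta0 mul0r addr0 => ->.
Qed.

(** Now [2 ^ eta * f0 = 0] forces [f0 = 2 * x], and a coboundary that reduces [x] modulo
    [2 ^ (v - 1)] also moves [gamma] by a multiple of [2 ^ eta = 2 ^ (r - v) * 2 ^ (v - 1)]. The
    shift by [z1] in the second coordinate merely relabels [z2]. *)
Lemma complete_family_plus_eq : (1 < v)%N -> r = eta.+1 ->
  complete_family act
    [set ((2 * z1)%N%:R, (2 ^ (r - v) * z2)%N%:R - (2 ^ (r - v) * z1)%N%:R)
       | z1 : 'I_(2 ^ v.-1), z2 : 'I_(2 ^ v)].
Proof.
move=> v_gt1 rE.
have rB : (r - eta = 1)%N by lia.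
have v_le := ltnW v_lt; have vE : v = v.-1.+1 by rewrite prednK // ltnW.
have rv : 2 ^+ v * 2 ^+ (r - v) = 0 :> 'Z_(2 ^ r).
  by rewrite -exprD subnKC // Zp_pow2_ge.
have powv : 2 ^+ v = 2 * 2 ^+ v.-1 :> 'Z_(2 ^ r) by rewrite -exprS -vE.
have etav : 2 ^+ eta = 2 ^+ (r - v) * 2 ^+ v.-1 :> 'Z_(2 ^ r).
  by rewrite -exprD; congr (_ ^+ _); lia.
have eta2 : 2 ^+ eta * 2 = 0 :> 'Z_(2 ^ r) by rewrite -exprSr Zp_pow2_ge // rE.
apply: complete_family_power.
- move=> _ /imset2P[z1 z2 _ _ ->] /=; rewrite sum_plus_eq0 cB1.
  by rewrite !natrM !natrX -mulrBr plus_mul_pow2 mulrA eta2 mul0r oppr0.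
- move=> f0 gamma /sum_plus_eq0 f0_eq; rewrite cB1 f0_eq oppr0 => /plus_mul_eq0[y ->].
  have [|x ->] := Zp_pow2_mul_eq0 r_gt0 _ f0_eq; first by rewrite rE.
  rewrite rB expr1.
  have [z1 [t1 ->]] := Zp_pow2_div v.-1 x.
  (* The term [z1%:R] undoes the shift in the family; the last term offsets the effect on [gamma],
     divided by [2 ^ (r - v)], of the coboundary of [- (w^-1 * t1)]. *)
  have [z2 [t2 yE]] := Zp_pow2_div v (y + z1%:R + 2 ^+ v.-1 * (w^-1 * t1)).
  exists ((2 * z1)%N%:R, (2 ^ (r - v) * z2)%N%:R - (2 ^ (r - v) * z1)%N%:R).
    by apply/imset2P; exists z1 z2.
  exists (- (w^-1 * t1)); rewrite cB1' !natrM !natrX /=; split.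
    have -> : - (2 ^+ v * w) * - (w^-1 * t1) = 2 ^+ v * t1.
      by rewrite mulrN mulNr opprK mulrA mulrK.
    by rewrite powv; ring.
  have -> : y = z2%:R - z1%:R - 2 ^+ v.-1 * (w^-1 * t1) + 2 ^+ v * t2.
    by rewrite -[_ - _ - _ + _]addrAC -[_ - z1%:R + _]addrAC -yE; ring.
  rewrite etav mulrDr [2 ^+ (r - v) * (2 ^+ v * _)]mulrA [2 ^+ (r - v) * 2 ^+ v]mulrC rv.
  by ring.
- move=> _ _ t /imset2P[z1 z2 _ _ ->] /imset2P[z1' z2' _ _ ->] /=.
  rewrite cB1' => f0_eq gamma_eq.
  have lt2 (z : 'I_(2 ^ v.-1)) : (2 * z < 2 ^ v)%N by rewrite {2}vE expnS ltn_pmul2l.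
  have : Ordinal (lt2 z1) = Ordinal (lt2 z1').
    by apply: (Zp_pow2_rem_inj r_gt0 v_le (t := - (w * t))); rewrite /= f0_eq; ring.
  move=> /(congr1 (@nat_of_ord _)) /eqP; rewrite /= eqn_pmul2l // => /eqP z1E.
  (* With equal first coordinates [t] is killed by [2 ^ v], hence even because [v < r]; so it does
     not move [gamma]. *)
  have [y tE] : exists y, t = 2 ^+ (r - v) * y.
    apply: plus_mul_eq0; apply: oppr_inj; rewrite oppr0 -mulNr.
    by apply: (addrI (2 * z1')%N%:R); rewrite addr0 -f0_eq z1E.
  have eta_t : 2 ^+ eta * t = 0.
    by rewrite tE -(prednK (n := r - v)) ?subn_gt0 // exprS !mulrA eta2 !mul0r.
  by rewrite gamma_eq eta_t addr0 z1E.
Qed.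

End PlusCase.

(** The only condition left is [2 * w * gamma = 2 ^ eta * f0]. It is solved by
    [gamma = 2 ^ (eta - 1) * f0], and two solutions differ by an element killed by 2, that is by a
    multiple of [2 ^ (r - 1)]. Coboundaries reduce [f0] modulo 2. *)
Lemma complete_family_minus (k : 'Z_(2 ^ r)) : (r <= eta.+1)%N -> c = - (1 + 4 * k) ->
  complete_family act
    [set (z1%:R, (2 ^ (r - 1) * z2 + 2 ^ (eta - 1) * z1)%N%:R) | z1 : 'I_2, z2 : 'I_2].
Proof.
move=> r_le ck.
have eta2 : 2 ^+ eta * 2 = 0 :> 'Z_(2 ^ r) by rewrite -exprSr Zp_pow2_ge.
have etaE : 2 ^+ eta = 2 * 2 ^+ (eta - 1) :> 'Z_(2 ^ r) by rewrite -exprS subn1 prednK.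
have rE : 2 * 2 ^+ (r - 1) = 0 :> 'Z_(2 ^ r).
  by rewrite -exprS subn1 prednK // Zp_pow2_ge.
have w_unit := Zp_pow2_unit r_gt0 k; set w := 1 + 2 * k in w_unit.
have sum0 : \sum_(j < 2 ^ eta) c ^+ j = 0.
  rewrite ck -(prednK eta_gt0); have [y ->] := sum_expr_N1D4 k eta.-1.
  by rewrite prednK // Zp_pow2_ge // mul0r.
have cB1' : 1 - c = 2 * w by rewrite ck /w; ring.
have cB1 : c - 1 = - (2 * w) by rewrite -cB1' opprB.
have etaw x : 2 ^+ eta * (w * x) = 2 ^+ eta * x.
  by rewrite /w mulrDl mul1r mulrDr !mulrA eta2 !mul0r addr0.
apply: complete_family_power; rewrite ?sum0.
- move=> _ /imset2P[z1 z2 _ _ ->] /=; rewrite mul0r; split=> //.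
  rewrite cB1 natrD !natrM !natrX -etaw etaE.
  have -> : - (2 * w) * (2 ^+ (r - 1) * z2%:R + 2 ^+ (eta - 1) * z1%:R) =
     - (2 * 2 ^+ (r - 1) * (w * z2%:R)) - 2 * 2 ^+ (eta - 1) * (w * z1%:R) by ring.
  by rewrite rE mul0r oppr0 add0r.
- move=> f0 gamma _; rewrite cB1 -etaw.
  have [z1 [t1 ->]] := Zp_pow2_div 1 f0; rewrite expr1 => gE.
  pose t := w^-1 * t1.
  (* The particular solution for [z1] and the coboundary of [t] are removed from [gamma]; the rest
     is killed by 2. *)
  pose g := gamma - 2 ^+ (eta - 1) * z1%:R - 2 ^+ eta * t.
  have [|y yE] := @Zp_pow2_mul_eq0 r r_gt0 1 g r_gt0.
    have gE' : 2 * w * gamma = 2 ^+ eta * (w * z1%:R).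
      apply: oppr_inj; rewrite -mulNr gE.
      have -> : 2 ^+ eta * (w * (z1%:R + 2 * t1)) =
          2 ^+ eta * (w * z1%:R) + (2 ^+ eta * 2) * (w * t1) by ring.
      by rewrite eta2 mul0r addr0.
    apply: (mulrI w_unit); rewrite mulr0 expr1 /g.
    transitivity (2 * w * gamma - 2 * 2 ^+ (eta - 1) * (w * z1%:R)
        - 2 ^+ eta * 2 * (w * t)); first by ring.
    by rewrite gE' -etaE eta2 mul0r subr0 subrr.
  have [z2 [t2 y2E]] := Zp_pow2_div 1 y.
  exists (z1%:R, (2 ^ (r - 1) * z2 + 2 ^ (eta - 1) * z1)%N%:R).
    by apply/imset2P; exists z1 z2.
  exists t; rewrite cB1' /=; split.
    by rewrite /t mulrA -[2 * w * _]mulrA divrr // mulr1.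
  rewrite natrD !natrM !natrX.
  have -> : 2 ^+ (r - 1) * z2%:R = 2 ^+ (r - 1) * y.
    by rewrite y2E mulrDr expr1 mulrA [_ * 2]mulrC rE mul0r addr0.
  by rewrite -yE /g; ring.
- move=> _ _ t /imset2P[z1 z2 _ _ ->] /imset2P[z1' z2' _ _ ->] /=.
  rewrite cB1' => f0_eq.
  have z1E : z1 = z1'.
    by apply: (@Zp_pow2_rem_inj r r_gt0 1 _ _ (w * t)) => //; rewrite f0_eq expr1 mulrA.
  (* Equal first coordinates give [2 * w * t = 0], so [t] is a multiple of [2 ^ (r - 1)] and its
     coboundary is zero. *)
  have [|y tE] := @Zp_pow2_mul_eq0 r r_gt0 1 t r_gt0.
    apply: (mulrI w_unit); rewrite mulr0 expr1 mulrA [w * 2]mulrC.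
    by apply: (addrI z1'%:R); rewrite addr0 -f0_eq z1E.
  have eta_t : 2 ^+ eta * t = 0.
    rewrite tE etaE.
    transitivity (2 ^+ (eta - 1) * (2 * 2 ^+ (r - 1)) * y); first by ring.
    by rewrite rE mulr0 mul0r.
  by rewrite eta_t addr0 z1E => ->.
Qed.

End PowerAction.

(** * Binomial expansions of powers and of their sums *)

Section BinomialSums.

Variable R : comNzRingType.

Lemma expr_1D (x : R) h : (1 + x) ^+ h = \sum_(i < h.+1) 'C(h, i)%:R * x ^+ i.
Proof.
by rewrite exprDn; apply: eq_bigr => i _; rewrite expr1n mul1r mulr_natl.
Qed.

(** Formally both sides are [((1 + x) ^ h - 1) / x]; induction with Pascal's rule avoids the
    division, as [x] will be the nilpotent [4 * k]. *)
Lemma sum_expr_1D (x : R) h :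
  \sum_(j < h) (1 + x) ^+ j = \sum_(l < h) 'C(h, l.+1)%:R * x ^+ l.
Proof.
elim: h => [|h IHh]; first by rewrite !big_ord0.
rewrite big_ord_recr /= IHh expr_1D.
under [RHS]eq_bigr do rewrite binS natrD mulrDl.
by rewrite big_split /= [X in _ = X + _]big_ord_recr /= bin_small // mul0r addr0.
Qed.

Lemma sum_expr_N1D (x : R) h :
  \sum_(j < h) (- (1 + x)) ^+ j = \sum_(l < h) (A_coef h l)%:~R * x ^+ l.
Proof.
elim: h => [|h IHh]; first by rewrite !big_ord0.
rewrite big_ord_recr /= IHh exprNn expr_1D mulr_sumr.
have AS (l : 'I_h.+1) : A_coef h.+1 l = A_coef h l + (-1) ^+ h * 'C(h, l)%:Z.
  by rewrite /A_coef big_nat_recr // -ltnS.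
under [RHS]eq_bigr do rewrite AS rmorphD rmorphM rmorphXn rmorphN rmorph1 mulrDl -mulrA.
rewrite big_split /= [X in _ = X + _]big_ord_recr /=.
by rewrite [A_coef h h]big_geq // mul0r addr0.
Qed.

Lemma sum_exprN1 h : \sum_(j < h) (-1) ^+ j = (odd h)%:R :> R.
Proof.
elim: h => [|h IHh]; first by rewrite big_ord0.
rewrite big_ord_recr /= IHh -signr_odd.
by case: (odd h); rewrite ?expr1 ?expr0 ?subrr ?add0r.
Qed.

End BinomialSums.

(** * Actions as powers of an odd number *)

Lemma act_power n m (act : add_action 'Z_n 'Z_m) h y : (1 < n)%N -> (1 < m)%N ->
  act h y = act 1 1 ^+ h * y.
Proof.
move=> n_gt1 m_gt1.
(* An additive endomorphism of a cyclic group is multiplication by the image of 1. *)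
have act_lin h' y' : act h' y' = act h' 1 * y'.
  by rewrite -(natr_Zp y') actMn mulr_natr.
have act_pow (i : nat) : act i%:R 1 = act 1 1 ^+ i.
  elim: i => [|i IHi]; first by rewrite act_zero.
  by rewrite mulrSr addrC act_addl IHi act_lin exprS.
by rewrite act_lin -{1}(natr_Zp h) act_pow.
Qed.

(** The action of [-1] inverts that of 1, so [act 1 1] is a unit modulo [2 ^ r]. *)
Lemma odd_act11 n r (act : add_action 'Z_n 'Z_(2 ^ r)) : (1 < n)%N -> (0 < r)%N ->
  odd (act 1 1).
Proof.
move=> n_gt1 r_gt0; have m_gt1 := pow2_gt1 r_gt0.
have : act 1 1 \is a GRing.unit.
  apply/unitrPr; exists (act (-1) 1).
  have := act_power act 1 (act (-1) 1) n_gt1 m_gt1.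
  by rewrite val_Zp1 expr1 -act_addl subrr act_zero => <-.
by rewrite -(natr_Zp (act 1 1)) unitZpE // coprime_pexpl // coprime2n natr_Zp.
Qed.

Lemma pm_power_action_exists eta r (act : add_action 'Z_(2 ^ eta) 'Z_(2 ^ r)) :
  (0 < eta)%N -> (2 < r)%N -> exists a k, is_pm_power_action act a k.
Proof.
move=> eta_gt0 r_gt2; have r_gt0 : (0 < r)%N by apply: ltn_trans r_gt2.
have n_gt1 := pow2_gt1 eta_gt0; have m_gt1 := pow2_gt1 r_gt0.
have c_lt := ltn_Zp (act 1 1) m_gt1; have c_odd := odd_act11 act n_gt1 r_gt0.
have actE h y := act_power act h y n_gt1 m_gt1.
move: (natr_Zp (act 1 1)) actE c_lt c_odd.
move: (act 1 1) => c; move: (nat_of_ord c) => x cE actE x_lt x_odd.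
have rE : (2 ^ r = 4 * 2 ^ (r - 2))%N by rewrite -(expnD 2 2) subnKC // ltnW.
have [x1|x3] : (x %% 4 = 1)%N \/ (x %% 4 = 3)%N.
- by move: x_odd; lia.
- exists (1 + 4 * (x %/ 4))%N%:Z, (x %/ 4)%N; split; [lia|by left|move=> h y].
  by rewrite rmorphXn /= -pmulrn actE -cE; congr (_%:R ^+ _ * _); lia.
(* When [x] is 3 modulo 4, the opposite [2 ^ r - x] is 1 modulo 4, with this quotient by 4. *)
- exists (- (1 + 4 * (2 ^ (r - 2) - 1 - x %/ 4))%N%:Z), (2 ^ (r - 2) - 1 - x %/ 4)%N.
  split; [lia|by right|move=> h y].
  rewrite rmorphXn /= rmorphN /= -pmulrn actE; congr (_ ^+ _ * _).
  apply/eqP; rewrite eq_sym eqr_oppLR -subr_eq0 opprK -cE -natrD; apply/eqP.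
  rewrite (_ : (_ + x)%N = (2 ^ r)%N) ?pchar_Zp //; lia.
Qed.

Theorem proposition4p7 (eta r : nat) (Heta : (1 <= eta)%N)
    (Hr : (3 <= r)%N) (Hreta : (r <= eta.+1)%N)
    (act : add_action 'Z_(2 ^ eta) 'Z_(2 ^ r)) :
  (exists (a : int) (k : nat), is_pm_power_action act a k) /\
  forall (a : int) (k : nat), is_pm_power_action act a k ->
  [/\ (* the decomposition k = 2^u s *)
      k <> 0%N ->
        exists u s : nat, [/\ (u < r - 2)%N, ~~ (2 %| s)%N & k = (2 ^ u * s)%N],
      (* k = 0 and a = 1 *)
      k = 0%N -> a = 1 ->
        [/\ (r <= eta)%N ->
              complete_family act
                [set (z1%:R, z2%:R) | z1 : 'I_(2 ^ r), z2 : 'I_(2 ^ r)],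
            r = eta.+1 ->
              complete_family act
                [set ((2 * z1)%N%:R, z2%:R) | z1 : 'I_(2 ^ (r - 1)), z2 : 'I_(2 ^ (r - 1))],
            forall (h : 'Z_(2 ^ eta)) (y : 'Z_(2 ^ r)), act h y = y &
            forall (f0 : 'Z_(2 ^ r)) (h h' : 'Z_(2 ^ eta)),
              f_of act f0 (h, h') = f0 * (h : nat)%:R * (h' : nat)%:R],
      (* k = 0 and a = -1 *)
      k = 0%N -> a = -1 ->
        [/\ complete_family act
              [set (z1%:R, (2 ^ (r - 1) * z2 + 2 ^ (eta - 1) * z1)%N%:R)
                 | z1 : 'I_2, z2 : 'I_2],
            forall (h : 'Z_(2 ^ eta)) (y : 'Z_(2 ^ r)), act h y = (-1) ^+ h * y &
            forall (f0 : 'Z_(2 ^ r)) (h h' : 'Z_(2 ^ eta)),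
              f_of act f0 (h, h') = if odd h then f0 * (h' : nat)%:R else 0],
      (* k <> 0 and a = 1 + 4k *)
      forall u s : nat, (u < r - 2)%N -> ~~ (2 %| s)%N -> k = (2 ^ u * s)%N ->
        k <> 0%N -> a = (1 + 4 * k)%N%:Z ->
        [/\ (r <= eta)%N ->
              complete_family act
                [set (z1%:R, (2 ^ (r - u - 2) * z2)%N%:R)
                   | z1 : 'I_(2 ^ (u + 2)), z2 : 'I_(2 ^ (u + 2))],
            r = eta.+1 ->
              complete_family act
                [set ((2 * z1)%N%:R,
                      (2 ^ (r - u - 2) * z2)%N%:R - (2 ^ (eta - u - 1) * z1)%N%:R)
                   | z1 : 'I_(2 ^ (u + 1)), z2 : 'I_(2 ^ (u + 2))],
            forall (h : 'Z_(2 ^ eta)) (y : 'Z_(2 ^ r)),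
              act h y = \sum_(i < (h : nat).+1) ('C(h, i) * 4 ^ i * k ^ i)%N%:R * y &
            forall (f0 : 'Z_(2 ^ r)) (h h' : 'Z_(2 ^ eta)),
              f_of act f0 (h, h') =
                \sum_(l < (h : nat)) ('C(h, l.+1) * 4 ^ l * k ^ l)%N%:R * f0 * (h' : nat)%:R] &
      (* k <> 0 and a = -1 - 4k *)
      k <> 0%N -> a = - (1 + 4 * k)%N%:Z ->
        [/\ complete_family act
              [set (z1%:R, (2 ^ (r - 1) * z2 + 2 ^ (eta - 1) * z1)%N%:R)
                 | z1 : 'I_2, z2 : 'I_2],
            forall (h : 'Z_(2 ^ eta)) (y : 'Z_(2 ^ r)),
              act h y =
                (-1) ^+ h * \sum_(i < (h : nat).+1) ('C(h, i) * 4 ^ i * k ^ i)%N%:R * y &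
            forall (f0 : 'Z_(2 ^ r)) (h h' : 'Z_(2 ^ eta)),
              f_of act f0 (h, h') =
                \sum_(l < (h : nat))
                  (A_coef h l * (4 ^ l * k ^ l)%N%:Z)%:~R * f0 * (h' : nat)%:R]].
Proof.
have r_gt0 : (0 < r)%N by apply: leq_trans Hr.
have n_gt1 := pow2_gt1 Heta.
have plusE (k : nat) : (1 + 4 * k)%N%:Z%:~R = 1 + 4 * k%:R :> 'Z_(2 ^ r).
  by rewrite -pmulrn natrD natrM.
split=> [|a k [k_lt a_pm act_a]]; first exact: pm_power_action_exists.
have actE h y : act h y = a%:~R ^+ h * y by rewrite act_a rmorphXn.
have f_ofE f0 (h h' : 'Z_(2 ^ eta)) :
    f_of act f0 (h, h') = (\sum_(j < h) a%:~R ^+ j) * f0 * (h' : nat)%:R.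
  rewrite ffunE /= -/(partial_sum act f0 h) (partial_sum_power Heta actE) ?mulr_natr //.
  exact/ltnW/ltn_Zp.
have expr4 x (i : nat) : (x * 4 ^ i * k ^ i)%N%:R = x%:R * (4 * k%:R) ^+ i :> 'Z_(2 ^ r).
  by rewrite !natrM !natrX exprMn mulrA.
split.
- move=> k_neq0; have k_gt0 : (0 < k)%N by rewrite lt0n; apply/eqP.
  have [//|s s_odd kE] := @pfactor_coprime 2 k _ k_gt0.
  (* The bound on the valuation [u] follows from [2 ^ u <= k < 2 ^ (r - 2)]. *)
  exists (logn 2 k), s; rewrite mulnC -kE; split=> //.
    rewrite -(ltn_exp2l _ _ (isT : (1 < 2)%N)) (leq_ltn_trans _ k_lt) //.
    by rewrite dvdn_leq // pfactor_dvdnn.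
  by rewrite -prime_coprime.
- move=> _ a1; have c1 : a%:~R = 1 :> 'Z_(2 ^ r) by rewrite a1.
  split.
  + exact: complete_family_trivial_le Heta r_gt0 actE c1.
  + exact: complete_family_trivial_eq Heta r_gt0 actE c1.
  + by move=> h y; rewrite actE c1 expr1n mul1r.
  + move=> f0 h h'; rewrite f_ofE c1; congr (_ * _); rewrite mulrC; congr (_ * _).
    under eq_bigr do rewrite expr1n.
    by rewrite sumr_const card_ord.
- move=> k0 aN1; have cN1 : a%:~R = -1 :> 'Z_(2 ^ r) by rewrite aN1.
  split.
  + apply: (complete_family_minus Heta r_gt0 actE (k := 0) Hreta).
    by rewrite mulr0 addr0.
  + by move=> h y; rewrite actE cN1.
  + by move=> f0 h h'; rewrite f_ofE cN1 sum_exprN1; case: odd; rewrite ?mul1r ?mul0r.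
- move=> u s u_lt s_odd kE k_neq0 aE.
  have ck : a%:~R = 1 + 4 * k%:R :> 'Z_(2 ^ r) by rewrite aE plusE.
  have s_unit : s%:R \is a @GRing.unit 'Z_(2 ^ r).
    by rewrite unitZpE ?pow2_gt1 // coprime_pexpl // prime_coprime.
  have k4 : 4 * k%:R = 2 ^+ (u + 2) * s%:R :> 'Z_(2 ^ r).
    by rewrite kE natrM natrX exprD; ring.
  have v_lt : (u + 2 < r)%N by lia.
  have rv : (r - u - 2 = r - (u + 2))%N by rewrite subnDA.
  split.
  + rewrite rv; exact (complete_family_plus_le Heta r_gt0 actE s_unit v_lt ck k4).
  + move=> rE; have -> : (eta - u - 1 = r - (u + 2))%N by lia.
    rewrite rv (_ : (u + 1 = (u + 2).-1)%N); last by rewrite addn2 addn1.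
    apply: (complete_family_plus_eq Heta r_gt0 actE s_unit v_lt ck k4) => //.
    by rewrite addn2.
  + move=> h y; rewrite actE ck expr_1D mulr_suml.
    by apply: eq_bigr => i _; rewrite expr4.
  + move=> f0 h h'; rewrite f_ofE ck sum_expr_1D !mulr_suml.
    by apply: eq_bigr => l _; rewrite expr4.
- move=> k_neq0 aE.
  have ck : a%:~R = - (1 + 4 * k%:R) :> 'Z_(2 ^ r) by rewrite aE rmorphN /= plusE.
  split.
  + exact (complete_family_minus Heta r_gt0 actE Hreta ck).
  + move=> h y; rewrite actE ck [in LHS]exprNn expr_1D -mulrA mulr_suml.
    by congr (_ * _); apply: eq_bigr => i _; rewrite expr4.
  + move=> f0 h h'; rewrite f_ofE ck sum_expr_N1D !mulr_suml.
    apply: eq_bigr => l _; rewrite rmorphM /= -[in RHS]pmulrn.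
    by rewrite -[(4 ^ l * k ^ l)%N]mul1n mulnA expr4 mul1r.
Qed.
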